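(* For all binary relations $R$ and $S$ on IMP states and all IMP commands $c$ and $c'$: if $\vDash \langle R\rangle\ c,\ c'\ \langle S\rangle$ holds (i.e. for all states $t,t'$ with $S(t,t')$ there exist states $s,s'$ with $R(s,s')$, $(c,s)\Rightarrow t$ and $(c',s')\Rightarrow t'$), then $\vdash \langle R\rangle\ c,\ c'\ \langle S\rangle$ is derivable in the proof system described in the context.
   Context: IMP commands: $c ::= x := e \mid c;c \mid \mathbf{if}\ b\ \mathbf{then}\ c\ \mathbf{else}\ c \mid \mathbf{while}\ b\ \mathbf{do}\ c \mid \mathbf{skip}$, where $x$ ranges over program variables, $e$ over integer arithmetic expressions and $b$ over boolean expressions. A state $s$ maps variables to integers; $[e]_s$, $[b]_s$ denote evaluation in $s$, and $s(x:=v)$ is $s$ updated at $x$. $(c,s)\Rightarrow t$ is the standard big-step semantics: $(\mathbf{skip},s)\Rightarrow s$; $(x:=e,s)\Rightarrow s(x:=[e]_s)$; $(c_1;c_2,s)\Rightarrow u$ if $(c_1,s)\Rightarrow t$ and $(c_2,t)\Rightarrow u$; $\mathbf{if}\ b\ \mathbf{then}\ c_1\ \mathbf{else}\ c_2$ from $s$ runs $c_1$ if $[b]_s$ is true and $c_2$ otherwise; $(\mathbf{while}\ b\ \mathbf{do}\ c,s)\Rightarrow s$ if $[b]_s$ is false; if $[b]_s$ is true, $(c,s)\Rightarrow t$ and $(\mathbf{while}\ b\ \mathbf{do}\ c,t)\Rightarrow u$ then $(\mathbf{while}\ b\ \mathbf{do}\ c,s)\Rightarrow u$. Relations are binary relations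 on states. Under-approximate relational validity: $\vDash \langle R\rangle\ c,\ c'\ \langle S\rangle$ iff $\forall t\,t'.\ S(t,t') \implies \exists s\,s'.\ R(s,s')\land (c,s)\Rightarrow t\land (c',s')\Rightarrow t'$. Notation: $R\land S$, $R\lor S$ are pointwise on pairs; $b^1 \equiv \lambda s\,s'.\,[b]_s$; for a family $R(n)$, $n\in\mathbb{N}$, $\exists n.R(n)\equiv\lambda s\,s'.\,\exists n.\,R(n)(s,s')$; $R\implies S$ means $R\subseteq S$; $\overleftrightarrow{R}\equiv\lambda s\,s'.\,R(s',s)$; $R[x:=e]\equiv \lambda s\,s'.\ \exists v.\ R(s(x:=v),s')\land s(x)=[e]_{s(x:=v)}$. The judgement $\vdash\langle R\rangle\ c,\ c'\ \langle S\rangle$ is inductively defined by the rules: (Skip) if $\forall t\,t'.\ S(t,t')\implies\exists s'.\ R(t,s')\land (c',s')\Rightarrow t'$ then $\vdash\langle R\rangle\ \mathbf{skip},\ c'\ \langle S\rangle$; (Seq1) from $\vdash\langle R\rangle\ c,\ c'\ \langle S\rangle$ and $\vdash\langle S\rangle\ d,\ \mathbf{skip}\ \langle T\rangle$ infer $\vdash\langle R\rangle\ (c;d),\ c'\ \langle T\rangle$; (Assign) from $\vdash\langle R[x:=e]\rangle\ \mathbf{skip},\ c'\ \langle S\rangle$ infer $\vdash\langle R\rangle\ x:=e,\ c'\ \langle S\rangle$; (IfTrue) from $\vdash\langle R\land b^1\rangle\ c_1,\ c'\ \langle S\rangle$ infer $\vdash\langle R\rangle\ \mathbf{if}\ b\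 \mathbf{then}\ c_1\ \mathbf{else}\ c_2,\ c'\ \langle S\rangle$; (IfFalse) from $\vdash\langle R\land (\lnot b)^1\rangle\ c_2,\ c'\ \langle S\rangle$ infer the same conclusion; (WhileFalse) from $\vdash\langle R\land(\lnot b)^1\rangle\ \mathbf{skip},\ c'\ \langle S\rangle$ infer $\vdash\langle R\rangle\ \mathbf{while}\ b\ \mathbf{do}\ c,\ c'\ \langle S\rangle$; (WhileTrue) from $\vdash\langle R\land b^1\rangle\ (c;\mathbf{while}\ b\ \mathbf{do}\ c),\ c'\ \langle S\rangle$ infer $\vdash\langle R\rangle\ \mathbf{while}\ b\ \mathbf{do}\ c,\ c'\ \langle S\rangle$; (Back-Var) from $\forall n.\ \vdash\langle R(n)\land b^1\rangle\ c,\ \mathbf{skip}\ \langle R(n+1)\rangle$ and $\vdash\langle \exists n.R(n)\rangle\ \mathbf{while}\ b\ \mathbf{do}\ c,\ c'\ \langle S\rangle$ infer $\vdash\langle R(0)\rangle\ \mathbf{while}\ b\ \mathbf{do}\ c,\ c'\ \langle S\rangle$; (Conseq) from $R_1\implies R_2$, $\vdash\langle R_1\rangle\ c,\ c'\ \langle S_1\rangle$ and $S_2\implies S_1$ infer $\vdash\langle R_2\rangle\ c,\ c'\ \langle S_2\rangle$; (Disj) from $\vdash\langle R_1\rangle\ c,\ c'\ \langle S_1\rangle$ and $\vdash\langle R_2\rangle\ c,\ c'\ \langle S_2\rangle$ infer $\vdash\langle R_1\lor R_2\rangle\ c,\ c'\ \langle S_1\lor S_2\rangle$; (Sym) from $\vdash\langle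 \overleftrightarrow{R}\rangle\ c',\ c\ \langle \overleftrightarrow{S}\rangle$ infer $\vdash\langle R\rangle\ c,\ c'\ \langle S\rangle$. *)

(* Defs.v *)
From Stdlib Require Import ZArith Relations.

Set Implicit Arguments.
Unset Strict Implicit.

(* The grammar of IMP expressions is a parameter: the language enters only
   through the evaluation of its arithmetic and boolean expressions in a
   state. *)
Record exp_lang : Type := ExpLang {
  var : Type;
  var_eq_dec : forall x y : var, {x = y} + {x <> y};
  aexp : Type;
  bexp : Type;
  aeval : aexp -> (var -> Z) -> Z;
  beval : bexp -> (var -> Z) -> bool
}.

Definition state (L : exp_lang) : Type := var L -> Z.

Definition update (L : exp_lang) (s : state L) (x : var L) (v : Z) : state L :=
  fun y => if var_eq_dec x y then v else s y.

Inductive com (L : exp_lang) : Type :=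
| Assign (x : var L) (e : aexp L)
| Seq (c1 c2 : com L)
| If (b : bexp L) (c1 c2 : com L)
| While (b : bexp L) (c : com L)
| Skip.

Arguments Skip {L}.

Inductive big_step (L : exp_lang) : com L -> state L -> state L -> Prop :=
| big_skip s :
    big_step Skip s s
| big_assign x e s :
    big_step (Assign x e) s (update s x (aeval e s))
| big_seq c1 c2 s t u :
    big_step c1 s t -> big_step c2 t u -> big_step (Seq c1 c2) s u
| big_if_true b c1 c2 s t :
    beval b s = true -> big_step c1 s t -> big_step (If b c1 c2) s t
| big_if_false b c1 c2 s t :
    beval b s = false -> big_step c2 s t -> big_step (If b c1 c2) s t
| big_while_false b c s :
    beval b s = false -> big_step (While b c) s s
| big_while_true b c s t u :
    beval b s = true -> big_step c s t -> big_step (While b c) t u ->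
    big_step (While b c) s u.

Definition rel (L : exp_lang) : Type := relation (state L).

Definition rel_and (L : exp_lang) (R S : rel L) : rel L :=
  fun s s' => R s s' /\ S s s'.

Definition rel_ex (L : exp_lang) (R : nat -> rel L) : rel L :=
  fun s s' => exists n, R n s s'.

(* [b^1] and [(not b)^1]. *)
Definition holds1 (L : exp_lang) (b : bexp L) : rel L :=
  fun s _ => beval b s = true.

Definition fails1 (L : exp_lang) (b : bexp L) : rel L :=
  fun s _ => beval b s = false.

(* [R[x := e]]: the strongest postcondition of assigning on the left, [v] being
   the value of [x] before the assignment. *)
Definition rel_assign (L : exp_lang) (R : rel L) (x : var L) (e : aexp L) :
    rel L :=
  fun s s' => exists v : Z,
    R (update s x v) s' /\ s x = aeval e (update s x v).

Definition valid (L : exp_lang) (R : rel L) (c c' : com L) (S : rel L) : Prop :=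
  forall t t', S t t' ->
    exists s s', R s s' /\ big_step c s t /\ big_step c' s' t'.

Inductive derivable (L : exp_lang) :
    rel L -> com L -> com L -> rel L -> Prop :=
| der_skip (R S : rel L) c' :
    (forall t t', S t t' -> exists s', R t s' /\ big_step c' s' t') ->
    derivable R Skip c' S
| der_seq1 (R S T : rel L) c d c' :
    derivable R c c' S -> derivable S d Skip T ->
    derivable R (Seq c d) c' T
| der_assign (R S : rel L) x e c' :
    derivable (rel_assign R x e) Skip c' S ->
    derivable R (Assign x e) c' S
| der_if_true (R S : rel L) b c1 c2 c' :
    derivable (rel_and R (holds1 b)) c1 c' S ->
    derivable R (If b c1 c2) c' S
| der_if_false (R S : rel L) b c1 c2 c' :
    derivable (rel_and R (fails1 b)) c2 c' S ->
    derivable R (If b c1 c2) c' S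
| der_while_false (R S : rel L) b c c' :
    derivable (rel_and R (fails1 b)) Skip c' S ->
    derivable R (While b c) c' S
| der_while_true (R S : rel L) b c c' :
    derivable (rel_and R (holds1 b)) (Seq c (While b c)) c' S ->
    derivable R (While b c) c' S
| der_back_var (R : nat -> rel L) (S : rel L) b c c' :
    (forall n, derivable (rel_and (R n) (holds1 b)) c Skip (R (n + 1))) ->
    derivable (rel_ex R) (While b c) c' S ->
    derivable (R 0) (While b c) c' S
| der_conseq (R1 R2 S1 S2 : rel L) c c' :
    inclusion _ R1 R2 -> derivable R1 c c' S1 -> inclusion _ S2 S1 ->
    derivable R2 c c' S2
| der_disj (R1 R2 S1 S2 : rel L) c c' :
    derivable R1 c c' S1 -> derivable R2 c c' S2 ->
    derivable (union _ R1 R2) c c' (union _ S1 S2)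
| der_sym (R S : rel L) c c' :
    derivable (transp _ R) c' c (transp _ S) ->
    derivable R c c' S.

(* Main.v *)
From Stdlib Require Import Relations FunctionalExtensionality PeanoNat.
Require Import Defs.

(** Induction on [c] with [c'], [R] and [S] arbitrary: every rule for [c] is
    applied with the strongest intermediate relation, and (Skip) discharges [c']
    semantically. For a loop, the strongest relations after [n] iterations serve
    as the (Back-Var) family, which is then left by (WhileFalse). *)

Lemma update_update (L : exp_lang) (s : state L) x v w :
  update (update s x v) x w = update s x w.
Proof.
  apply functional_extensionality; intro y; unfold update.
  now destruct (var_eq_dec x y).
Qed.

Lemma update_same (L : exp_lang) (s : state L) x : update s x (s x) = s.
Proof.
  apply functional_extensionality; intro y; unfold update.
  now destruct (var_eq_dec x y); subst.
Qed.

Lemma update_eq (L : exp_lang) (s : state L) x v : update s x v x = v.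
Proof. unfold update; now destruct (var_eq_dec x x). Qed.

(** The last iteration is outermost, so passing from [n] to [n + 1] is one guarded run of [c], as
    (Back-Var) demands; [t'] stays fixed because [Skip] runs on the right there. *)
Fixpoint while_iter (L : exp_lang) (R : rel L) (b : bexp L) (c : com L)
    (n : nat) : rel L :=
  match n with
  | 0 => R
  | S n => fun t t' => exists s,
      while_iter L R b c n s t' /\ beval b s = true /\ big_step c s t
  end.

(** Induction on the run of the loop: each iteration passes from the remaining run into the counter,
    hence the arbitrary [n]. *)
Lemma big_step_while_inv (L : exp_lang) (R : rel L) b c s t s' n :
  big_step (While b c) s t -> while_iter L R b c n s s' ->
  (exists m, while_iter L R b c m t s') /\ beval b t = false.
Proof.
  intro H; remember (While b c) as w eqn:E; revert n.
  induction H; inversion E; subst; intros n Hn.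
  - eauto.
  - apply (IHbig_step2 eq_refl (Datatypes.S n)); simpl; eauto.
Qed.

Theorem theorem2 (L : exp_lang) (R S : rel L) (c c' : com L) :
  valid R c c' S -> derivable R c c' S.
Proof.
  revert R S c'.
  induction c as [x e|c1 IH1 c2 IH2|b c1 IH1 c2 IH2|b c IH|]; intros R S c' V.
  - apply der_assign, der_skip; intros t t' HS.
    destruct (V t t' HS) as (s & s' & HR & Hc & Hc').
    inversion Hc; subst; exists s'; split; [|assumption].
    (* The old value of [x] undoes the assignment and restores [s]. *)
    exists (s x); now rewrite update_update, update_same, update_eq.
  (* All of [c'] runs alongside [c1], since (Seq1) leaves only [Skip] beside [c2]. *)
  - apply der_seq1 with (S := fun t t' => exists s s',
      R s s' /\ big_step c1 s t /\ big_step c' s' t').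
    + apply IH1; intros t t' H; exact H.
    + apply IH2; intros u t' HS.
      destruct (V u t' HS) as (s & s' & HR & Hc & Hc').
      inversion Hc; subst; eauto 10 using big_skip.
  - set (post B c := fun t t' => exists s s',
      rel_and R B s s' /\ big_step c s t /\ big_step c' s' t').
    (* [R] is doubled to fit (Disj); each pair in [S] is reached through one of the branches, so the
       two posts cover [S]. *)
    apply der_conseq with (R1 := union _ R R)
      (S1 := union _ (post (holds1 b) c1) (post (fails1 b) c2)).
    + intros s s' [HR|HR]; exact HR.
    + apply der_disj.
      * apply der_if_true, IH1; intros t t' H; exact H.
      * apply der_if_false, IH2; intros t t' H; exact H.
    + intros t t' HS; destruct (V t t' HS) as (s & s' & HR & Hc & Hc').
      inversion Hc; subst; [left|right]; exists s, s'; now repeat split.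
  - apply (der_back_var (R := while_iter L R b c)).
    + intro n; rewrite Nat.add_1_r; apply IH; intros t t' (s & Hs & Hb & Hc).
      exists s, t'; repeat split; auto using big_skip.
    + apply der_while_false, der_skip; intros t t' HS.
      destruct (V t t' HS) as (s & s' & HR & Hc & Hc').
      exists s'; split; [|assumption].
      exact (big_step_while_inv L R b c s t s' 0 Hc HR).
  - apply der_skip; intros t t' HS.
    destruct (V t t' HS) as (s & s' & HR & Hc & Hc').
    inversion Hc; subst; eauto.
Qed.
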